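(* Let $\ell\geqslant 3$ be an integer and let $p,q$ be positive integers written as $p=(\ell-2)r+e$ and $q=(\ell-2)s+f$ with integers $r,s\geqslant 0$, $1\leqslant e\leqslant \ell-2$ and $1\leqslant f\leqslant \ell-2$. If $r<s$, then $$m(p,q,\ell)=(\ell-1)(p-1)+q.$$
   Context: All graphs are simple. An ordered bipartite graph $(G;A,B)$ is a bipartite graph $G$ whose vertex set is partitioned into independent sets $A$ and $B$, each equipped with a linear order. Two vertices $u<v$ of the same part are consecutive if no vertex $w$ of that part satisfies $u<w<v$. Identifying two consecutive vertices $u,v$ replaces them by a single vertex $w$ (in their place in the order) whose neighbourhood is the union of the neighbourhoods of $u$ and $v$. Two ordered bipartite graphs are isomorphic if there is a graph isomorphism between them that maps parts to parts (possibly exchanging the two parts) and preserves both linear orders. An ordered bipartite graph $H$ is an interval minor of $G$ if a graph isomorphic to $H$ can be obtained from $G$ by repeatedly deleting edges and identifying consecutive vertices; otherwise $G$ is $H$-interval minor free. $ex(p,q,H)$ denotes the maximum number of edges of an ordered bipartite graph with parts of sizes $p$ and $q$ (the first part of size $p$, the second of size $q$) that is $H$-interval minor free, and $m(p,q,\ell)$ denotes $ex(p,q,K_{2,\ell})$, where $K_{2,\ell}$ is the complete bipartite graph with parts of sizes $2$ and $\ell$. *)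

(* Defs.v *)
From mathcomp Require Import all_boot.
From mathcomp Require Import boolp.
From Stdlib Require Import Relation_Operators.

Set Implicit Arguments.
Unset Strict Implicit.
Unset Printing Implicit Defensive.

(* A finite linearly ordered set is represented by the ordinals 'I_n, to which
   it is isomorphic in exactly one way. The vertices are the disjoint union of
   the two parts; (a, b) \in edges means that a in A is adjacent to b in B. *)
Record obigraph := OBigraph {
  sizeA : nat;
  sizeB : nat;
  edges : {set 'I_sizeA * 'I_sizeB}
}.

Definition exchange (G : obigraph) : obigraph :=
  OBigraph [set (x.2, x.1) | x in edges G].

Definition part_iso (G H : obigraph) : Prop :=
  exists (f : 'I_(sizeA G) -> 'I_(sizeA H)) (g : 'I_(sizeB G) -> 'I_(sizeB H)),
  [/\ bijective f, bijective g,
      {mono f : x y / x <= y}, {mono g : x y / x <= y} &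
      forall a b, ((f a, g b) \in edges H) = ((a, b) \in edges G)].

Definition obigraph_iso (G H : obigraph) : Prop :=
  part_iso G H \/ part_iso (exchange G) H.

Lemma merge_ord_subproof (n : nat) (i : 'I_n) (k : 'I_n.+1) : unbump i k < n.
Proof.
rewrite /unbump; case: (ltnP i k) => [lt_ik|le_ki] /=.
  by rewrite subn1 prednK ?(leq_ltn_trans _ lt_ik) // -ltnS.
by rewrite subn0 (leq_ltn_trans le_ki).
Qed.

(* [merge_ord i] sends the consecutive elements i and i+1 to i and is otherwise
   injective and order preserving. *)
Definition merge_ord (n : nat) (i : 'I_n) (k : 'I_n.+1) : 'I_n :=
  Ordinal (merge_ord_subproof i k).

Inductive minor_step : obigraph -> obigraph -> Prop :=
| DeleteEdge (p q : nat) (E : {set 'I_p * 'I_q}) (x : 'I_p * 'I_q) :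
    x \in E -> minor_step (OBigraph E) (OBigraph (E :\ x))
| IdentifyA (p q : nat) (E : {set 'I_p.+1 * 'I_q}) (i : 'I_p) :
    minor_step (OBigraph E) (OBigraph [set (merge_ord i x.1, x.2) | x in E])
| IdentifyB (p q : nat) (E : {set 'I_p * 'I_q.+1}) (j : 'I_q) :
    minor_step (OBigraph E) (OBigraph [set (x.1, merge_ord j x.2) | x in E]).

Definition interval_minor (H G : obigraph) : Prop :=
  exists2 G', clos_refl_trans obigraph minor_step G G' & obigraph_iso G' H.

Definition interval_minor_free (H G : obigraph) : Prop := ~ interval_minor H G.

(* The maximum of an empty family is 0 here; for H = K_{2,l} with l > 0 the
   edgeless graph is always in the family. *)
Definition ex_number (p q : nat) (H : obigraph) : nat :=
  \max_(E : {set 'I_p * 'I_q} | `[< interval_minor_free H (OBigraph E) >]) #|E|.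

Definition complete_obigraph (k l : nat) : obigraph :=
  OBigraph [set: 'I_k * 'I_l].

Definition m (p q l : nat) : nat := ex_number p q (complete_obigraph 2 l).

(* Main.v *)
(** View G as a p x q matrix, rows being A. An interval minor K_{k,l} amounts to
    monotone maps of the rows onto k and of the columns onto l classes such that
    every pair of classes contains an edge.

    Upper bound: a column with k edges crosses at least k - 1 of the p - 1 cuts
    between consecutive rows, and a cut crossed by l columns yields K_{2,l}; so
    the edges number at most (l - 1)(p - 1) + q.

    Lower bound: with t = l - 2 and X i = t * floor(i / t), let row i (from 0)
    be the interval [X i, X (i+1) + t] of columns, and the last row
    [X (p-1), q - 1]. Successive rows share exactly t + 1 columns, so the count
    telescopes to the upper bound. For every cut of the rows (columns), any
    interval of columns (rows) with edges on both sides of the cut meets a fixed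
    window of t + 1 consecutive indices, so fewer than l disjoint ones exist. *)

Require Import Defs.
From mathcomp Require Import all_boot.
From mathcomp Require Import boolp zify.
From Stdlib Require Import Relation_Operators.

Set Implicit Arguments.
Unset Strict Implicit.
Unset Printing Implicit Defensive.

(** * Monotone models of interval minors *)

(** Only the edges of [H] have to lift; edges of [G] may land on non-edges, which absorbs deletions.
    Surjectivity is not imposed, since it follows when [H] is complete with nonempty parts. *)
Definition covering (G H : obigraph) (f : 'I_(sizeA G) -> 'I_(sizeA H))
    (g : 'I_(sizeB G) -> 'I_(sizeB H)) : Prop :=
  [/\ {homo f : x y / x <= y}, {homo g : x y / x <= y} &
      forall y, y \in edges H -> exists2 x, x \in edges G & (f x.1, g x.2) = y].

Lemma covering_comp (G H K : obigraph) f g f' g' :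
  @covering G H f g -> @covering H K f' g' ->
  @covering G K (f' \o f) (g' \o g).
Proof.
case=> hf hg hE [hf' hg' hE']; split=> [x y xy|x y xy|y /hE'] /=.
- exact/hf'/hf.
- exact/hg'/hg.
by case=> z /hE [x xE <-] <-; exists x.
Qed.

Lemma merge_ord_homo n (i : 'I_n) : {homo merge_ord i : x y / x <= y}.
Proof. by move=> x y xy /=; rewrite /unbump; lia. Qed.

Lemma minor_step_covering (G H : obigraph) :
  minor_step G H -> exists f g, @covering G H f g.
Proof.
case=> [p q E x _|p q E i|p q E j].
- exists id, id; split=> //= y; rewrite inE => /andP[_ yE].
  by exists y => //; case: y yE.
- exists (merge_ord i), id; split=> //=; first exact: merge_ord_homo.
  by move=> y /imsetP[x xE ->]; exists x.
- exists id, (merge_ord j); split=> //=; first exact: merge_ord_homo.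
  by move=> y /imsetP[x xE ->]; exists x.
Qed.

Lemma minor_covering (G H : obigraph) :
  clos_refl_trans obigraph minor_step G H -> exists f g, @covering G H f g.
Proof.
elim=> [{}G {}H|{}G|{}G {}H K _ [f [g hfg]] _ [f' [g' hfg']]].
- exact: minor_step_covering.
- by exists id, id; split=> // -[a b] abE; exists (a, b).
- by exists (f' \o f), (g' \o g); apply: covering_comp hfg hfg'.
Qed.

Lemma exchange_covering (G H : obigraph) f g :
  @covering G H f g -> @covering (exchange G) (exchange H) g f.
Proof.
case=> hf hg hE; split=> // y /imsetP[z /hE[x xE <-] ->].
by exists (x.2, x.1) => //; apply/imsetP; exists x.
Qed.

Lemma part_iso_covering (G H : obigraph) :
  part_iso G H -> exists f g, @covering G H f g.
Proof.
case=> f [g [bf bg mf mg hE]]; exists f, g; split.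
- by move=> x y; rewrite mf.
- by move=> x y; rewrite mg.
case: bf bg => [f' _ f'K] [g' _ g'K] [a b] abE.
by exists (f' a, g' b); rewrite -?hE /= ?f'K ?g'K.
Qed.

Lemma interval_minor_covering (G H : obigraph) :
  interval_minor H G ->
  (exists f g, @covering G H f g) \/ (exists f g, @covering (exchange G) H f g).
Proof.
case=> G' /minor_covering[f [g hfg]] [] /part_iso_covering[f' [g' hfg']].
- by left; exists (f' \o f), (g' \o g); apply: covering_comp hfg hfg'.
right; exists (f' \o g), (g' \o f).
exact: covering_comp (exchange_covering hfg) hfg'.
Qed.

(** * Contracting a model of a complete graph *)

(** Without a collision [f] is strictly increasing, so [j <= f j] for all [j], and the value at the
    last index [n >= k] is out of range. *)
Lemma homo_collision n k (f : 'I_n.+1 -> 'I_k) :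
  k <= n -> {homo f : x y / x <= y} ->
  exists i : 'I_n, f (widen_ord (leqnSn n) i) = f (lift ord0 i).
Proof.
move=> kn hf; apply: contrapT => hn.
suff h (j : nat) (jn : j < n.+1) : j <= f (Ordinal jn).
  by have := h n (ltnSn n); have := ltn_ord (f (Ordinal (ltnSn n))); lia.
elim: j jn => // j IH jn.
have jn' : j < n by [].
have := IH (ltnW jn).
have -> : Ordinal (ltnW jn) = widen_ord (leqnSn n) (Ordinal jn') by apply: val_inj.
have -> : Ordinal jn = lift ord0 (Ordinal jn') by apply: val_inj.
move=> /leq_ltn_trans; apply; rewrite ltn_neqAle hf /= ?leqW // andbT.
by apply/negP => /eqP /val_inj e; apply: hn; exists (Ordinal jn').
Qed.

Lemma homo_merge n k (f : 'I_n.+1 -> 'I_k) :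
  k <= n -> {homo f : x y / x <= y} ->
  exists (i : 'I_n) (f' : 'I_n -> 'I_k),
    {homo f' : x y / x <= y} /\ forall x, f' (merge_ord i x) = f x.
Proof.
move=> kn hf; have [i ei] := homo_collision kn hf.
(* The new map reads [f] off the representatives that skip [i + 1]; the collision makes this agree
   with [f] at [i + 1] too. *)
exists i, (f \o lift (lift ord0 i)); split=> [x y xy|x] /=.
  by apply: hf; rewrite /= /bump; lia.
have [xi|xi] := eqVneq (x : nat) i.+1.
  have -> : x = lift ord0 i by apply: val_inj; rewrite /= xi.
  rewrite -ei; congr f; apply: val_inj.
  by rewrite /= /bump /unbump /=; lia.
congr f; apply: val_inj; rewrite /= /bump /unbump /=.
by move: xi; lia.
Qed.

(* A model of a complete graph survives any identification inside a fibre, and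
   once the fibres are singletons all edges are present. *)
Lemma covering_complete_minor k l (G : obigraph) f g :
  @covering G (complete_obigraph k.+1 l.+1) f g ->
  interval_minor (complete_obigraph k.+1 l.+1) G.
Proof.
case: G f g => p q E; have [N] := ubnP (p + q).
elim: N p q E => // N IH p q E pqN f g [/= hf hg hE].
have hE' a b : exists2 x, x \in E & (f x.1, g x.2) = (a, b) by apply: hE; rewrite inE.
have step G' f' g' : minor_step (OBigraph E) G' -> sizeA G' + sizeB G' < N ->
    @covering G' (complete_obigraph k.+1 l.+1) f' g' ->
    interval_minor (complete_obigraph k.+1 l.+1) (OBigraph E).
  case: G' f' g' => p' q' E' f' g' s lt /(IH _ _ _ lt) [K sK iK].
  by exists K => //; apply: rt_trans sK; apply: rt_step.
have surjf a : exists x, f x = a by have [x _ [<- _]] := hE' a ord0; exists x.1.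
have surjg b : exists x, g x = b by have [x _ [_ <-]] := hE' ord0 b; exists x.2.
have surj_leq a b (h : 'I_a -> 'I_b) : (forall y, exists x, h x = y) -> b <= a.
  move=> sh; rewrite -[b]card_ord -[a]card_ord -(card_codom (f := id)) //.
  apply: leq_trans (leq_image_card h predT); apply: subset_leq_card.
  by apply/subsetP => y _; have [x <-] := sh y; apply: image_f.
have kp : k.+1 <= p := surj_leq _ _ _ surjf.
have lq : l.+1 <= q := surj_leq _ _ _ surjg.
have [pk|] := ltnP k.+1 p.
  case: p => // p in E pqN f g hf hg hE hE' step surjf surjg kp pk *.
  have [i [f' [hf' ef']]] := @homo_merge p k.+1 f pk hf.
  apply: (step (OBigraph [set (merge_ord i x.1, x.2) | x in E]) f' g
    (IdentifyA E i)) => /=; first by lia.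
  split=> //= -[a b] _; have [x xE <-] := hE' a b.
  exists (merge_ord i x.1, x.2) => /=; last by rewrite ef'.
  by apply/imsetP; exists x.
have [ql|] := ltnP l.+1 q.
  case: q => // q in E pqN f g hf hg hE hE' step surjf surjg lq ql *.
  have [i [g' [hg' eg']]] := @homo_merge q l.+1 g ql hg.
  move=> _; apply: (step (OBigraph [set (x.1, merge_ord i x.2) | x in E]) f g'
    (IdentifyB E i)) => /=; first by lia.
  split=> //= -[a b] _; have [x xE <-] := hE' a b.
  exists (x.1, merge_ord i x.2) => /=; last by rewrite eg'.
  by apply/imsetP; exists x.
move=> ql pk.
have ep : p = k.+1 by lia.
have eq : q = l.+1 by lia.
subst p q; exists (OBigraph E); first exact: rt_refl.
left; exists id, id; split=> //; try by exists id.
(* A surjective self-map of a finite set is injective, so the edge lifting [(f a, g b)] can only be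
   [(a, b)]. *)
have surj_inj n (h : 'I_n -> 'I_n) : (forall y, exists x, h x = y) -> injective h.
  move=> sh; apply/injectiveP/card_uniqP; rewrite size_codom.
  by apply: eq_card => y; have [x <-] := sh y; rewrite codom_f.
move=> a b /=; rewrite inE.
have [[a' b'] xE [/= /(surj_inj _ _ surjf) <-]] := hE' (f a) (g b).
by move=> /(surj_inj _ _ surjg) <-.
Qed.

(** * Upper bound: columns crossing a cut of the rows *)

Lemma card_edges_rows p q (E : {set 'I_p * 'I_q}) :
  #|E| = \sum_(i < p) #|[set j | (i, j) \in E]|.
Proof.
rewrite -sum1_card big_mkcond /= (eq_bigr (fun x => ((x.1, x.2) \in E) : nat)).
  rewrite -(pair_bigA _ (fun i j => (((i, j) \in E) : nat))) /=.
  apply: eq_bigr => i _; rewrite -sum1_card [RHS]big_mkcond /=.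
  by apply: eq_bigr => j _; rewrite inE; case: ifP.
by case=> i j _; case: ifP.
Qed.

Lemma card_edges_columns p q (E : {set 'I_p * 'I_q}) :
  #|E| = \sum_(j < q) #|[set i | (i, j) \in E]|.
Proof.
rewrite card_edges_rows.
under eq_bigr do rewrite -sum1_card big_mkcond.
rewrite exchange_big; apply: eq_bigr => j _; rewrite -sum1_card [RHS]big_mkcond.
by apply: eq_bigr => i _; rewrite !inE.
Qed.


(** The cut [h] lies just before row [h], so nothing crosses cut 0 and [p - 1] genuine cuts
    remain. *)
Definition crossing p q (E : {set 'I_p * 'I_q}) (h : nat) : {set 'I_q} :=
  [set j | [exists i : 'I_p, [exists i' : 'I_p,
     [&& (i, j) \in E, (i', j) \in E & i < h <= i']]]].

(** Every edge of the column except the first is charged to the cut just before its own row, which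
    it crosses together with the first edge. *)
Lemma card_column_crossing p q (E : {set 'I_p * 'I_q}) (j : 'I_q) :
  #|[set i | (i, j) \in E]| <= (\sum_(h < p) (j \in crossing E h)).+1.
Proof.
set C := [set i | _]; have [->|[i0 i0C]] := set_0Vmem C; first by rewrite cards0.
case: (arg_minnP (fun i : 'I_p => i : nat) i0C) => i iC imin.
have {}iC : i \in C := iC.
rewrite (cardsD1 i) iC add1n ltnS -sum1_card big_mkcond /=.
apply: leq_sum => h _; case: ifP => //; rewrite !inE => /andP[hi hE].
rewrite lt0b; apply/existsP; exists i; apply/existsP; exists h.
move: iC; rewrite inE => ->; rewrite hE leqnn andbT /=.
have /imin ih : h \in C by rewrite inE.
rewrite ltn_neqAle ih andbT eq_sym.
by apply: contra hi => /eqP /val_inj ->.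
Qed.

Lemma card_edges_crossing p q (E : {set 'I_p * 'I_q}) (k : nat) :
  (forall h, #|crossing E h| <= k) -> #|E| <= k * (p - 1) + q.
Proof.
move=> hk; rewrite card_edges_columns.
apply: (@leq_trans (\sum_(j < q) (\sum_(h < p) (j \in crossing E h)).+1)).
  by apply: leq_sum => j _; apply: card_column_crossing.
under eq_bigr do rewrite -addn1.
rewrite big_split /= sum1_card card_ord leq_add2r exchange_big /=.
have cr h : \sum_(j < q) (j \in crossing E h) = #|crossing E h|.
  by rewrite -sum1_card [RHS]big_mkcond; apply: eq_bigr => j _; case: ifP.
under eq_bigr do rewrite cr.
case: p => [|n] in E hk cr *; first by rewrite big_ord0.
rewrite big_ord_recl.
have -> : #|crossing E (@ord0 n)| = 0.
  apply/eqP; rewrite cards_eq0; apply/eqP/setP => j; rewrite !inE.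
  by apply/negbTE/negP => /existsP[i /existsP[i' /and3P[_ _]]].
apply: (@leq_trans (\sum_(h < n) k)); first by apply: leq_sum => h _; apply: hk.
by rewrite sum_nat_const card_ord subn1 mulnC.
Qed.

Lemma homo_onto_set q l (S : {set 'I_q}) :
  l < #|S| -> exists g : 'I_q -> 'I_l.+1,
    {homo g : x y / x <= y} /\ forall c, exists2 s, s \in S & g s = c.
Proof.
move=> lS; pose rk (j : 'I_q) := #|[set s in S | s < j]|.
have rk_le (x y : 'I_q) : x <= y -> rk x <= rk y.
  move=> xy; apply: subset_leq_card; apply/subsetP => z; rewrite !inE.
  by case/andP=> -> /leq_trans; apply.
have rk_lt (x y : 'I_q) : x \in S -> x < y -> rk x < rk y.
  move=> xS xy; apply: proper_card; apply/properP; split.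
    apply/subsetP => z; rewrite !inE; case/andP=> -> zx /=; exact: ltn_trans xy.
  by exists x; rewrite !inE ?xS // ltnn andbF.
have rk_max x : x \in S -> rk x < #|S|.
  move=> xS; apply: proper_card; apply/properP; split.
    by apply/subsetP => z; rewrite !inE => /andP[].
  by exists x => //; rewrite inE ltnn andbF.
(* The class of a column is its rank in [S], capped at [l]. Ranks map [S] bijectively onto the
   integers below [#|S|], so each class is hit from [S]. *)
exists (fun j => inord (minn (rk j) l)); split=> [x y /rk_le xy|c].
  by rewrite !inordK; lia.
have S0 : 0 < #|S| by lia.
pose r (x : 'I_q) : 'I_#|S| := insubd (Ordinal S0) (rk x).
have rE x : x \in S -> r x = rk x :> nat.
  by move=> xS; rewrite /r val_insubd rk_max.
have r_inj : {in S &, injective r}.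
  move=> x y xS yS /(congr1 val) /=; rewrite !rE // => exy; apply: val_inj => /=.
  by case: (ltngtP x y) => // /rk_lt; [move=> /(_ xS)|move=> /(_ yS)]; rewrite exy ltnn.
have full : r @: S = setT.
  by apply/eqP; rewrite eqEcard subsetT cardsT card_ord card_in_imset /=.
have cS : c < #|S| by apply: leq_ltn_trans lS; rewrite -ltnS.
have /imsetP[s sS /(congr1 val) /= es] : Ordinal cS \in r @: S by rewrite full inE.
exists s => //; apply: val_inj; rewrite /= inordK -?rE -?es //; last lia.
by apply/minn_idPl; rewrite -ltnS.
Qed.

Lemma crossing_minor p q (E : {set 'I_p * 'I_q}) h l :
  l < #|crossing E h| ->
  interval_minor (complete_obigraph 2 l.+1) (OBigraph E).
Proof.
move=> /homo_onto_set[g [hg gonto]].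
pose f (i : 'I_p) : 'I_2 := inord (h <= i).
apply: (@covering_complete_minor 1 l (OBigraph E) f g); split=> //=.
  by move=> x y xy; rewrite /f !inordK; case: (leqP h x) => //=; lia.
move=> [a c] _; have [s] := gonto c; rewrite inE.
case/existsP=> i /existsP[i' /and3P[iE i'E /andP[ih hi']]] <-.
have [a0|a1] := posnP a.
  exists (i, s) => //=; congr pair; apply: val_inj.
  by rewrite /f leqNgt ih /= inordK.
exists (i', s) => //=; congr pair; apply: val_inj.
by rewrite /f hi' /= inordK //; have := ltn_ord a; lia.
Qed.

(** * Lower bound: the staircase *)

(** Every fibre of [g] meets the window from [a] to [a + t]: if [x] and [y] both miss it then
    [x < a < y], and monotonicity puts [a] in the fibre. Hence there are at most [t + 1] fibres. *)
Lemma homo_window n l t a (g : 'I_n -> 'I_l) :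
  a < n -> {homo g : x y / x <= y} ->
  (forall c, exists x y, [/\ g x = c, g y = c, x <= a + t & a <= y]) ->
  l <= t.+1.
Proof.
(* The window may run past [n]; the excess indices default to [a], which is harmless because [W]
   only has to reach each element of the window. *)
move=> an hg hc; pose W (k : 'I_t.+1) : 'I_n := insubd (Ordinal an) (a + k).
have WE (j : 'I_n) : a <= j -> j <= a + t -> exists k, W k = j.
  move=> aj jt; have jat : j - a < t.+1 by lia.
  exists (Ordinal jat); apply: val_inj; rewrite val_insubd /= subnKC //.
  by rewrite ltn_ord.
rewrite -[l]card_ord -[t.+1]card_ord.
apply: leq_trans (leq_image_card (g \o W) predT); apply: subset_leq_card.
apply/subsetP => c _; have [x [y [gx gy xt ay]]] := hc c.
suff [k <-] : exists k, g (W k) = c by apply: image_f.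
have [ax|xa] := leqP a x; first by have [k ek] := WE _ ax xt; exists k; rewrite ek.
have [yt|ty] := leqP y (a + t); first by have [k ek] := WE _ ay yt; exists k; rewrite ek.
have [k ek] := WE (Ordinal an) (leqnn a) (leq_addr t a).
exists k; rewrite ek; apply: val_inj; apply/eqP; rewrite eqn_leq.
by rewrite -{1}gy -gx !hg //=; lia.
Qed.

Section Staircase.
Variables (t p q : nat).

Definition row_start (i : nat) := t * (i %/ t).

(** The end is exclusive, hence [t.+1] for an overlap of [t + 1] columns with the next row. *)
Definition row_end (i : nat) :=
  if i.+1 < p then row_start i.+1 + t.+1 else q.

Definition staircase : {set 'I_p * 'I_q} :=
  [set x : 'I_p * 'I_q | row_start x.1 <= x.2 < row_end x.1].

Lemma row_start_le i j : i <= j -> row_start i <= row_start j.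
Proof. by move=> ij; rewrite leq_mul2l leq_div2r ?orbT. Qed.

Lemma sum_interval n a b :
  b <= n -> \sum_(j < n) (a <= j < b) = b - a.
Proof.
suff -> : \sum_(j < n) (a <= j < b) = minn b n - a by move=> /minn_idPl ->.
by elim: n => [|n IH]; rewrite ?big_ord0 ?big_ord_recr /= ?IH; lia.
Qed.

Hypothesis t_gt0 : 0 < t.
(** Keeps every row but the last, with its full overlap, inside the [q] columns; the theorem derives
    it from [r < s]. *)
Hypothesis fits : row_start p.-1 + t < q.

Lemma row_end_le i : row_end i <= q.
Proof.
rewrite /row_end; case: ifP => // ip.
have := @row_start_le i.+1 p.-1; lia.
Qed.

Lemma card_staircase : 0 < p -> #|staircase| = t.+1 * (p - 1) + q.
Proof.
move=> p0; rewrite card_edges_rows.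
have row i : #|[set j | (i, j) \in staircase]| = row_end i - row_start i.
  rewrite -(@sum_interval q) ?row_end_le // -sum1_card big_mkcond.
  by apply: eq_bigr => j _; rewrite !inE /=; case: ifP.
rewrite (eq_bigr _ (fun i _ => row i)).
rewrite -(big_mkord xpredT (fun i => row_end i - row_start i)).
(* Each row but the last contributes [t + 1] plus the shift to the next start; the shifts add up to
   [row_start n], which the last row cancels. *)
have part n : n < p ->
    \sum_(0 <= i < n) (row_end i - row_start i) = t.+1 * n + row_start n.
  elim: n => [|n IH] np; first by rewrite big_nil muln0 /row_start div0n muln0.
  rewrite big_nat_recr //= IH; last by lia.
  rewrite /row_end np.
  by have := row_start_le (leqnSn n); lia.
have -> : p = (p.-1).+1 by lia.
rewrite big_nat_recr //= part ?prednK // /row_end prednK // ltnn.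
by rewrite subn1; lia.
Qed.

Lemma staircase_rows_free l (f : 'I_p -> 'I_2) (g : 'I_q -> 'I_l) :
  t.+1 < l ->
  ~ @covering (OBigraph staircase) (complete_obigraph 2 l) f g.
Proof.
move=> tl [/= hf hg hE].
have hE' a c : exists (i : 'I_p) (j : 'I_q), [/\ row_start i <= j < row_end i, f i = a & g j = c].
  have [|[i j] + [<- <-]] := hE (a, c); first by rewrite inE.
  by rewrite inE; exists i, j.
have c0 : 'I_l by exists 0; lia.
have [i1 [_ [_ fi1 _]]] := hE' ord_max c0.
have i1P : f i1 = 1 :> nat by rewrite fi1.
case: (@arg_minnP _ i1 (fun i => f i == 1 :> nat) (@nat_of_ord p)).
  by rewrite i1P.
move=> h /eqP fh hmin.
have hq : row_start h < q.
  have := @row_start_le h p.-1; have := ltn_ord h; lia.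
suff : l <= t.+1 by lia.
(* Here [h] is the first row of the upper class: earlier rows stop by column [row_start h + t], and
   the others start no earlier than [row_start h]. *)
apply: (@homo_window q l t (row_start h) g) => // c.
have [i [j [/andP[_ ij] fi gj]]] := hE' ord0 c.
have [i' [j' [/andP[ij' _] fi' gj']]] := hE' ord_max c.
have ih : i < h.
  by rewrite ltnNge; apply/negP => /hf; rewrite fi fh.
have hi' : h <= i' by apply: hmin; rewrite fi'.
exists j, j'; split=> //; last exact: leq_trans (row_start_le hi') ij'.
move: ij; rewrite /row_end; case: ifP => [_|]; last by have := ltn_ord h; lia.
have := row_start_le ih; lia.
Qed.

Lemma staircase_columns_free l (f : 'I_q -> 'I_2) (g : 'I_p -> 'I_l) :
  t.+1 < l ->
  ~ @covering (exchange (OBigraph staircase)) (complete_obigraph 2 l) f g.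
Proof.
move=> tl [/= hf hg hE].
have hE' a c : exists (i : 'I_p) (j : 'I_q), [/\ row_start i <= j < row_end i, f j = a & g i = c].
  have [|[j i] + [<- <-]] := hE (a, c); first by rewrite inE.
  by case/imsetP=> -[i' j']; rewrite inE /= => ij [-> ->]; exists i', j'.
have c0 : 'I_l by exists 0; lia.
have [i0 [j0 [_ fj0 _]]] := hE' ord_max c0.
case: (@arg_minnP _ j0 (fun j => f j == 1 :> nat) (@nat_of_ord q)).
  by rewrite fj0.
move=> h /eqP fh hmin.
have p0 : p.-1 < p by have := ltn_ord i0; lia.
have h0 : 0 < h.
  have [_ [j [_ fj _]]] := hE' ord0 c0.
  rewrite lt0n; apply/eqP => h0.
  by have /hf : h <= j by [lia]; rewrite fh fj.
pose k := h.-1 %/ t.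
suff : l <= t.+1 by lia.
(* A row with an edge before column [h] has [i %/ t <= k], so [i <= t * k + t - 1]; one with an edge
   from [h] on satisfies [t * k <= i' + 1]. The window thus starts at [t * k - 1], capped so that it
   is a row. *)
apply: (@homo_window p l t (minn (t * k).-1 p.-1) g) => // [|c]; first by lia.
have [i [j [/andP[ij _] fj gi]]] := hE' ord0 c.
have [i' [j' [/andP[_ ij'] fj' gi']]] := hE' ord_max c.
have jh : j < h.
  by rewrite ltnNge; apply/negP => /hf; rewrite fj fh.
have hj' : h <= j' by apply: hmin; rewrite fj'.
exists i, i'; split=> //.
  have ik : i %/ t <= k.
    by rewrite leq_divRL // mulnC; apply: leq_trans ij _; lia.
  have := ltn_ceil i t_gt0; have := ltn_ord i.
  have : (i %/ t).+1 * t <= k.+1 * t by rewrite leq_mul2r ltnS ik orbT.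
  lia.
move: ij'; rewrite /row_end /row_start; case: ifP => [_ j'lt|]; last first.
  by have := ltn_ord i'; lia.
have : k < (i'.+1 %/ t).+1.
  by rewrite ltn_divLR //; lia.
rewrite ltnS => /(leq_mul (leqnn t)) ki'.
have := leq_divM i'.+1 t; lia.
Qed.

End Staircase.

Theorem theorem2p3 (l p q r s e f : nat)
  (hl : 3 <= l) (hp0 : 0 < p) (hq0 : 0 < q)
  (hp : p = (l - 2) * r + e) (hq : q = (l - 2) * s + f)
  (he : 1 <= e <= l - 2) (hf : 1 <= f <= l - 2)
  (hrs : r < s) :
  m p q l = (l - 1) * (p - 1) + q.
Proof.
have lE : l = (l - 2).+2 by lia.
have l1E : l - 1 = (l - 2).+1 by lia.
set t := l - 2 in hp hq he hf lE l1E.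
have t0 : 0 < t by lia.
(* Since [e - 1 < t], the last row starts at [t * r], and [t * r + t <= t * s < q] by [r < s] and
   [1 <= f]. *)
have fits : row_start t p.-1 + t < q.
  have -> : row_start t p.-1 = t * r.
    have -> : p.-1 = r * t + e.-1 by lia.
    by rewrite /row_start divnMDl // divn_small ?addn0; lia.
  by have := leq_mul (leqnn t) hrs; lia.
rewrite /m /ex_number l1E; apply/eqP; rewrite eqn_leq; apply/andP; split.
  apply/bigmax_leqP => E /asboolP free; apply: card_edges_crossing => h.
  by rewrite leqNgt; apply/negP => /crossing_minor; rewrite -lE.
rewrite -card_staircase //; apply: leq_bigmax_cond.
(* The two cases are the two ways of matching the parts: the side of size 2 comes from the rows or
   from the columns. *)
apply/asboolP => /interval_minor_covering[] [g [h]].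
  by apply: staircase_rows_free => //; lia.
by apply: staircase_columns_free => //; lia.
Qed.
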